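(* Assume the optimal value of $\mathcal{P}^{\infty}_{\mathrm{dual}}$ (defined in the context) is finite, let $(\boldsymbol\mu^*,\boldsymbol\lambda^* )$ be its optimal solution, and let $\mathcal{K}^\infty_{sel}=\{k:\lambda_k^*>0\}$. Lagrange variables $(\boldsymbol x,\boldsymbol z,z)$ satisfying the KKT conditions of $\mathcal{P}^{\infty}_{\mathrm{dual}}$ at $(\boldsymbol\mu^*,\boldsymbol\lambda^* )$ must satisfy the following: 1. $x_k\ge0$ for all $k$; 2. $\mu_k^*x_k=0$ for all $k$; 3. $\lambda_k^*=F_k(\boldsymbol\lambda^*,\mu_k^*,\gamma_k)$ for all $k$; 4. $\sum_{k=1}^L\mu_k^*=L$; 5. $z=\frac{\sigma^2}{L}\sum_{k=1}^L\beta_k\lambda_k^*$; 6. for all $k\in\mathcal{K}^\infty_{sel}$, $x_k=z-P_k$, where $\{P_k:k\in\mathcal{K}^\infty_{sel}\}$ are the unique solution of the linear equations $$\frac{P_k\epsilon_{k,k}}{\beta_k\left(\sigma^2+\sum_{j\in\mathcal{K}^\infty_{sel}}\frac{P_j\epsilon_{k,j}}{\left(1+\lambda_k^*\epsilon_{k,j}\frac{\gamma_j}{\epsilon_{j,j}\lambda_j^*}\right)^2}\right)}=\gamma_k',\qquad k\in\mathcal{K}^\infty_{sel},$$ with $$\gamma_k'=\gamma_k\left[\frac{\mu_k^*+\sum_{j\in\mathcal{K}^\infty_{sel}}\frac{\beta_j\lambda_j^*\epsilon_{j,k}}{1+\lambda_j^*\epsilon_{j,k}\frac{\gamma_k}{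\epsilon_{k,k}\lambda_k^*}}}{\mu_k^*+\sum_{j\in\mathcal{K}^\infty_{sel}}\frac{\beta_j\lambda_j^*\epsilon_{j,k}}{\left(1+\lambda_j^*\epsilon_{j,k}\frac{\gamma_k}{\epsilon_{k,k}\lambda_k^*}\right)^2}}\right].$$
   Context: Let $L\ge1$ be an integer and let $\sigma^2>0$, $\beta_k>0$, $\gamma_k>0$, $\epsilon_{j,k}>0$ for $j,k\in\{1,\dots,L\}$. $\mathcal{P}^{\infty}_{\mathrm{dual}}$ is: maximize $\sigma^2\sum_{k=1}^L\beta_k\lambda_k$ over $\boldsymbol\mu=(\mu_k)_{k=1}^L,\boldsymbol\lambda=(\lambda_k)_{k=1}^L$ subject to $\mu_k\ge0$, $\lambda_k\ge0$, $\sum_{k=1}^L(1-\mu_k)\ge0$, and $\lambda_k\le F_k(\boldsymbol\lambda,\mu_k,\gamma_k)$ for $k=1,\dots,L$, where $$F_k(\boldsymbol\lambda,\mu_k,\gamma_k)=\frac{\gamma_k}{\epsilon_{k,k}\,\bar m_k(-\mu_k,\boldsymbol\lambda)};$$ here $\bar m_k(-\mu_k,\boldsymbol\lambda)=m_k(-\mu_k,\boldsymbol\lambda)$ if $\mu_k>0$, or if $\mu_k=0$ and $\sum_j\beta_jI_{\lambda_j}>1$; and $\bar m_k=\infty$ (so that $F_k=0$) otherwise. $I_x$ equals $1$ if $x>0$ and $0$ otherwise, and $m_k=m_k(-\mu_k,\boldsymbol\lambda)$ is the unique positive solution of $$m_k=\frac{1}{\mu_k+\sum_{j=1}^L\frac{\beta_j\lambda_j\epsilon_{j,k}}{1+\lambda_j\epsilon_{j,k}m_k}}.$$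 When its optimal value is finite, $\mathcal{P}^{\infty}_{\mathrm{dual}}$ has a unique optimal solution. The Lagrangian is $$L(\boldsymbol\mu,\boldsymbol\lambda,\boldsymbol x,\boldsymbol z,z)=\sigma^2\sum_k\lambda_k\beta_k+\sum_k\mu_kx_k+z\sum_k(1-\mu_k)+\sum_kz_k\left(F_k(\boldsymbol\lambda,\mu_k,\gamma_k)-\lambda_k\right),$$ and the KKT conditions at a feasible point are: $x_k\ge0$, $z_k\ge0$, $z\ge0$; stationarity $\frac{\partial L}{\partial\mu_k}=0$ for all $k$ and $\frac{\partial L}{\partial\lambda_k}\le0$ for all $k$ with equality if $\lambda_k>0$ (derivatives being right derivatives at points where $\mu_k=0$ or $\lambda_k=0$); complementary slackness $\mu_kx_k=0$, $z\sum_k(1-\mu_k)=0$, $z_k(F_k(\boldsymbol\lambda,\mu_k,\gamma_k)-\lambda_k)=0$ for all $k$. *)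

(* Defs.v *)
(* Libraries: MathComp and MathComp-Analysis. *)
From HB Require Import structures.
From mathcomp Require Import all_boot all_order all_algebra.
From mathcomp Require Import all_classical all_reals all_analysis.
Set Implicit Arguments.
Unset Strict Implicit.
Unset Printing Implicit Defensive.
Import Order.TTheory GRing.Theory Num.Theory.
Import numFieldNormedType.Exports.
Local Open Scope classical_set_scope.
Local Open Scope ring_scope.

(* The indices 1, ..., L are represented by 'I_L, and vectors indexed
   by them by functions 'I_L -> R.  Arguments called [muk] are the single
   coordinate mu_k; those called [mu] are the whole vector. *)

(* The value m_k(-muk, lam), i.e. the positive solution of the fixed-point
   equation; where there is no such solution the value is the irrelevant 0. *)
Definition m_sol (R : realType) (L : nat) (beta : 'I_L -> R)
    (eps : 'I_L -> 'I_L -> R) (k : 'I_L) (muk : R) (lam : 'I_L -> R) : R :=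
  xget 0 [set m : R | 0 < m /\
    m = 1 / (muk + \sum_(j < L)
                     beta j * lam j * eps j k / (1 + lam j * eps j k * m))].

Definition m_bar (R : realType) (L : nat) (beta : 'I_L -> R)
    (eps : 'I_L -> 'I_L -> R) (k : 'I_L) (muk : R) (lam : 'I_L -> R) : \bar R :=
  if (0 < muk) || ((muk == 0) && (1 < \sum_(j < L) beta j * (0 < lam j)%R%:R))
  then (m_sol beta eps k muk lam)%:E else +oo%E.

(* Inversion on \bar R sends +oo to 0, so for eps k k > 0 this is 0
   when m_bar is +oo. *)
Definition F (R : realType) (L : nat) (beta : 'I_L -> R)
    (eps : 'I_L -> 'I_L -> R) (k : 'I_L) (lam : 'I_L -> R) (muk gammak : R)
    : R :=
  fine (gammak%:E / ((eps k k)%:E * m_bar beta eps k muk lam))%E.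

Definition dual_objective (R : realType) (L : nat) (sigma2 : R)
    (beta lam : 'I_L -> R) : R :=
  sigma2 * \sum_(k < L) beta k * lam k.

Definition dual_feasible (R : realType) (L : nat) (beta gamma : 'I_L -> R)
    (eps : 'I_L -> 'I_L -> R) (mu lam : 'I_L -> R) : Prop :=
  [/\ forall k, 0 <= mu k,
      forall k, 0 <= lam k,
      0 <= \sum_(k < L) (1 - mu k) &
      forall k, lam k <= F beta eps k lam (mu k) (gamma k)].

Definition dual_value (R : realType) (L : nat) (sigma2 : R)
    (beta gamma : 'I_L -> R) (eps : 'I_L -> 'I_L -> R) : \bar R :=
  ereal_sup [set v : \bar R | exists mu lam : 'I_L -> R,
    dual_feasible beta gamma eps mu lam /\
    v = (dual_objective sigma2 beta lam)%:E].

Definition dual_optimal (R : realType) (L : nat) (sigma2 : R)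
    (beta gamma : 'I_L -> R) (eps : 'I_L -> 'I_L -> R) (mu lam : 'I_L -> R)
    : Prop :=
  dual_feasible beta gamma eps mu lam /\
  forall mu' lam' : 'I_L -> R, dual_feasible beta gamma eps mu' lam' ->
    dual_objective sigma2 beta lam' <= dual_objective sigma2 beta lam.

Definition lagrangian (R : realType) (L : nat) (sigma2 : R)
    (beta gamma : 'I_L -> R) (eps : 'I_L -> 'I_L -> R)
    (mu lam x zk : 'I_L -> R) (z : R) : R :=
  sigma2 * \sum_(k < L) lam k * beta k
  + \sum_(k < L) mu k * x k
  + z * \sum_(k < L) (1 - mu k)
  + \sum_(k < L) zk k * (F beta eps k lam (mu k) (gamma k) - lam k).

(* [has_deriv_nneg f t d]: f is differentiable at t, with derivative d, as a
   function of a variable constrained to [0, +oo[: two-sided derivative for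
   t != 0, right derivative for t = 0.  Existence (as a finite limit) is part
   of the assertion. *)
Definition has_deriv_nneg (R : realType) (f : R -> R) (t d : R) : Prop :=
  if t == 0 then h^-1 * (f (t + h) - f t) @[h --> 0^'+] --> d
  else is_derive t (1 : R) f d.

(* [eta v with k |-> t] is the vector v with its k-th coordinate set to t. *)
Definition KKT (R : realType) (L : nat) (sigma2 : R)
    (beta gamma : 'I_L -> R) (eps : 'I_L -> 'I_L -> R)
    (mu lam x zk : 'I_L -> R) (z : R) : Prop :=
  [/\ (forall k, 0 <= x k) /\ (forall k, 0 <= zk k) /\ 0 <= z,
      forall k, has_deriv_nneg
        (fun t => lagrangian sigma2 beta gamma eps
                    [eta mu with k |-> t] lam x zk z) (mu k) 0,
      forall k, exists d : R,
        [/\ has_deriv_nneg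
              (fun t => lagrangian sigma2 beta gamma eps
                          mu [eta lam with k |-> t] x zk z) (lam k) d,
            d <= 0 & 0 < lam k -> d = 0] &
      [/\ forall k, mu k * x k = 0,
          z * \sum_(k < L) (1 - mu k) = 0 &
          forall k, zk k * (F beta eps k lam (mu k) (gamma k) - lam k) = 0]].

Definition K_sel (R : realType) (L : nat) (lam : 'I_L -> R) : {set 'I_L} :=
  finset (fun k : 'I_L => 0 < lam k).

Definition gamma' (R : realType) (L : nat) (beta gamma : 'I_L -> R)
    (eps : 'I_L -> 'I_L -> R) (mu lam : 'I_L -> R) (k : 'I_L) : R :=
  gamma k *
  ((mu k + \sum_(j in K_sel lam)
      beta j * lam j * eps j k /
      (1 + lam j * eps j k * (gamma k / (eps k k * lam k)))) /
   (mu k + \sum_(j in K_sel lam)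
      beta j * lam j * eps j k /
      (1 + lam j * eps j k * (gamma k / (eps k k * lam k))) ^+ 2)).

(* The equations determining P_k for k in K_sel lam; the values of P outside
   K_sel lam do not occur in them. *)
Definition power_equations (R : realType) (L : nat) (sigma2 : R)
    (beta gamma : 'I_L -> R) (eps : 'I_L -> 'I_L -> R)
    (mu lam P : 'I_L -> R) : Prop :=
  forall k, k \in K_sel lam ->
    P k * eps k k /
    (beta k * (sigma2 + \sum_(j in K_sel lam)
       P j * eps k j /
       (1 + lam k * eps k j * (gamma j / (eps j j * lam j))) ^+ 2))
    = gamma' beta gamma eps mu lam k.

(* Main.v *)
Require Import Defs.
From HB Require Import structures.
From mathcomp Require Import all_boot all_order all_algebra.
From mathcomp Require Import all_classical all_reals all_analysis.
From mathcomp Require Import ring.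
Import Order.TTheory GRing.Theory Num.Theory.
Import numFieldNormedType.Exports.
Local Open Scope classical_set_scope.
Local Open Scope ring_scope.

(** Write G_k = 1 / m_k, so that F_k is a multiple of G_k, and put
    b_j = lambda_j eps_jk.  Subtracting the fixed-point equations of (mu, b) and
    (mu', b') gives an exact identity for G' - G (lemma [fixpt_inv_sub]), from
    which F_k is nondecreasing in lambda, grows at least at rate
    gamma_k / eps_kk in mu_k, and has explicit right derivatives.

    Monotonicity in lambda and dL/dlambda_k <= 0 force z_k >= sigma2 beta_k > 0,
    hence lambda_k = F_k; growth in mu_k and dL/dmu_k = 0 force
    z - x_k > 0, hence z > 0 and sum mu_k = L.  With P_k = z - x_k the two
    stationarity conditions become, for k and j in K_sel,
    P_k = z_k lambda_k / Y_k, where Y_k is the denominator in gamma'_k, and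
    z_k = beta_k (sigma2 + sum_j P_j eps_kj / (1 + ...)^2).
    Eliminating z_k gives the power equations; multiplying by lambda_k and
    summing gives z L = sigma2 sum beta_k lambda_k.  The power equations have
    the form P = c + B P with c > 0 and B >= 0, so a positive solution is unique. *)

(** * The fixed-point equation and its dependence on [mu] and [b] *)

Definition is_fixpt {R : realType} {L : nat} (beta : 'I_L -> R)
    (mu : R) (b : 'I_L -> R) (m : R) : Prop :=
  0 < m /\ m * (mu + \sum_j beta j * b j / (1 + b j * m)) = 1.

(* [slope beta mu b m m] is the reciprocal of the derivative of 1 / m with
   respect to mu. *)
Definition slope {R : realType} {L : nat} (beta : 'I_L -> R)
    (mu : R) (b : 'I_L -> R) (m m' : R) : R :=
  m * (mu + \sum_j beta j * b j / ((1 + b j * m) * (1 + b j * m'))).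

Section FixedPoint.
Context {R : realType} {L : nat} {beta : 'I_L -> R}.
Hypothesis beta_gt0 : forall k, 0 < beta k.

Lemma den_gt0 {b m : R} : 0 <= b -> 0 < m -> 0 < 1 + b * m.
Proof. by move=> b0 m0; rewrite ltr_wpDr// mulr_ge0// ltW. Qed.

(** Split [b'/(1 + b'm') - b/(1 + bm)] at [b/(1 + bm')]. One piece is the summand on the right; the
    other is [m'^-1 - m^-1] times the summand of [S], and moves to the left, where the equation for
    [m] turns [1 - S] into [slope]. *)
Lemma fixpt_inv_sub {mu m mu' m' : R} {b b' : 'I_L -> R} :
  (forall j, 0 <= b j) -> (forall j, 0 <= b' j) ->
  is_fixpt beta mu b m -> is_fixpt beta mu' b' m' ->
  (m'^-1 - m^-1) * slope beta mu b m m' =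
  mu' - mu +
  \sum_j beta j * (b' j - b j) / ((1 + b' j * m') * (1 + b j * m')).
Proof.
move=> b0 b'0 [m0 em] [m'0 em'].
pose S := \sum_j beta j * b j ^+ 2 * (m * m') /
                 ((1 + b j * m) * (1 + b j * m')).
have -> : slope beta mu b m m' = 1 - S.
  apply/(canRL (addrK _)); rewrite -em /slope /S mulrDr -addrA mulrDr.
  congr (_ + _); rewrite !mulr_sumr -big_split; apply: eq_bigr => j _ /=.
  have := den_gt0 (b0 j) m0; have := den_gt0 (b0 j) m'0 => ? ?.
  by field; rewrite !lt0r_neq0.
rewrite mulrBr mulr1 mulr_sumr; apply/(canLR (addrK _)).
rewrite {1}(mulr1_eq em') {1}(mulr1_eq em) opprD addrACA -[RHS]addrA.
congr (_ + _); rewrite -sumrB -big_split; apply: eq_bigr => j _ /=.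
have := den_gt0 (b0 j) m0; have := den_gt0 (b0 j) m'0 => ? ?.
have := den_gt0 (b'0 j) m'0 => ?.
by field; rewrite !lt0r_neq0.
Qed.

(** The constant [C] dominates every [1 + b j * m'], so multiplying by it absorbs the second
    denominators and leaves at least the left side of the fixed-point equation, which is 1. *)
Lemma slope_gt0 {mu m m' : R} {b : 'I_L -> R} :
  0 <= mu -> (forall j, 0 <= b j) ->
  is_fixpt beta mu b m -> 0 < m' -> 0 < slope beta mu b m m'.
Proof.
move=> mu0 b0 [m0 em] m'0; pose C := 1 + (\sum_j b j) * m'.
have sb0 : 0 <= \sum_j b j by exact: sumr_ge0.
have C0 : 0 < C by exact: den_gt0.
rewrite -(pmulr_rgt0 _ C0); apply: (lt_le_trans ltr01).
rewrite -em /slope mulrCA ler_pM2l// mulrDr mulr_sumr lerD//.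
  by rewrite ler_peMl// lerDl mulr_ge0// ltW.
apply: ler_sum => j _.
have d0 := den_gt0 (b0 j) m0; have d'0 := den_gt0 (b0 j) m'0.
rewrite invfM.
rewrite [leRHS](_ : _ = beta j * b j / (1 + b j * m) * (C / (1 + b j * m')));
  last by ring.
apply: ler_peMr.
  by rewrite divr_ge0 ?mulr_ge0 ?(ltW d0) ?(ltW (beta_gt0 _)).
rewrite ler_pdivlMr// mul1r lerD2l ler_pM2r//.
by rewrite (bigD1 j)//= lerDl sumr_ge0.
Qed.

Lemma slope_le1 {mu m m' : R} {b : 'I_L -> R} :
  0 <= mu -> (forall j, 0 <= b j) ->
  is_fixpt beta mu b m -> 0 < m' -> slope beta mu b m m' <= 1.
Proof.
move=> mu0 b0 [m0 em] m'0; rewrite -em ler_pM2l// lerD2l ler_sum// => j _.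
have d0 := den_gt0 (b0 j) m0; have d'0 := den_gt0 (b0 j) m'0.
rewrite invfM mulrA; apply: ler_piMr.
  by rewrite divr_ge0 ?mulr_ge0 ?(ltW d0) ?(ltW (beta_gt0 _)).
by rewrite invf_le1// lerDl mulr_ge0// ltW.
Qed.

(** In [fixpt_inv_sub] the right side is at least [mu' - mu], hence nonnegative. Positivity of
    [slope] first gives the sign of [m'^-1 - m^-1]; only then does [slope <= 1] allow the factor to
    be dropped. *)
Lemma fixpt_inv_le {mu m mu' m' : R} {b b' : 'I_L -> R} :
  0 <= mu <= mu' -> (forall j, 0 <= b j <= b' j) ->
  is_fixpt beta mu b m -> is_fixpt beta mu' b' m' -> mu' - mu <= m'^-1 - m^-1.
Proof.
move=> /andP[mu0 lemu] bb' fm fm'.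
have b0 j : 0 <= b j by have /andP[] := bb' j.
have b'0 j : 0 <= b' j by have /andP[/le_trans] := bb' j; apply.
have [m'0 _] := fm'.
have := fixpt_inv_sub b0 b'0 fm fm'.
have := slope_gt0 mu0 b0 fm m'0; have := slope_le1 mu0 b0 fm m'0.
have : 0 <= \sum_j beta j * (b' j - b j) / ((1 + b' j * m') * (1 + b j * m')).
  apply: sumr_ge0 => j _; have := den_gt0 (b0 j) m'0.
  have := den_gt0 (b'0 j) m'0 => /ltW ? /ltW ?.
  rewrite divr_ge0 ?mulr_ge0//; first exact: ltW.
  by rewrite subr_ge0; have /andP[] := bb' j.
set S := \sum_j _; set d := _ - m^-1; set E := slope _ _ _ _ _.
move=> S0 E1 E0 dE.
have d0 : 0 <= d by rewrite -(pmulr_lge0 _ E0) dE addr_ge0// subr_ge0.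
apply: le_trans (_ : d * E <= _); first by rewrite dE lerDl.
by rewrite ler_piMr.
Qed.

(** Intermediate values of [y * (mu + ...)], which is 0 at 0 and reaches 1: at [mu^-1] if [mu > 0],
    and otherwise because the terms of the sum tend to [beta j] wherever [b j > 0]. *)
Lemma fixpt_exists {mu : R} {b : 'I_L -> R} : 0 <= mu -> (forall j, 0 <= b j) ->
  0 < mu \/ 1 < \sum_j beta j * (0 < b j)%R%:R ->
  exists m, is_fixpt beta mu b m.
Proof.
move=> mu0 b0 act.
(* The absolute value keeps all denominators at least 1, so [h] is continuous on the whole line. *)
pose h (y : R) := `|y| * (mu + \sum_j beta j * b j / (1 + b j * `|y|)).
have hc : continuous h.
  move=> y; apply: cvgM; first exact: cvg_norm.
  apply: cvgD; first exact: cvg_cst.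
  apply: (cvg_big add_continuous) => j _.
  apply: cvgM; first exact: cvg_cst.
  apply: cvgV; first by rewrite lt0r_neq0// ltr_wpDr// mulr_ge0.
  apply: cvgD; first exact: cvg_cst.
  apply: cvgM; first exact: cvg_cst.
  exact: cvg_norm.
have h0 : h 0 = 0 by rewrite /h normr0 mul0r.
have [X X0 hX] : exists2 X, 0 <= X & 1 <= h X.
  case: act => [mu_gt0|s_gt1].
    exists mu^-1; first by rewrite invr_ge0.
    rewrite /h ger0_norm ?invr_ge0// mulrDr mulVf ?lt0r_neq0// lerDl.
    rewrite mulr_ge0 ?invr_ge0// sumr_ge0// => j _.
    rewrite divr_ge0 ?mulr_ge0 ?(ltW (beta_gt0 _))//.
    by rewrite addr_ge0 ?mulr_ge0 ?invr_ge0.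
  pose s := \sum_j beta j * (0 < b j)%R%:R.
  (* Each term with [b j > 0] is at least [beta j - beta j / (b j * X)], so [X] is chosen to make
     the total loss at most [s - 1]. Terms with [b j = 0] vanish on both sides because
     [0^-1 = 0]. *)
  pose X := 1 + (\sum_j beta j / b j) / (s - 1).
  have bb0 : 0 <= \sum_j beta j / b j.
    by apply: sumr_ge0 => j _; rewrite divr_ge0// ltW.
  have X0 : 0 < X.
    by rewrite ltr_wpDr// divr_ge0// subr_ge0 ltW.
  exists X; first exact: ltW.
  rewrite /h ger0_norm ?(ltW X0)//.
  apply: le_trans (_ : s - (\sum_j beta j / b j) / X <= _).
    rewrite lerBrDr -lerBrDl ler_pdivrMr// /X mulrDr mulr1 mulrCA divff.
      by rewrite mulr1 lerDr subr_ge0 ltW.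
    by rewrite subr_eq0 gt_eqF.
  rewrite mulrDr mulr_sumr mulr_suml -sumrB ler_wpDl ?mulr_ge0 ?(ltW X0)//.
  apply: ler_sum => j _.
  have := b0 j; rewrite le_eqVlt => /predU1P[<-|bj0].
    by rewrite ltxx invr0 !(mulr0, mul0r) subr0.
  rewrite bj0 mulr1 -subr_ge0.
  have d0 := den_gt0 (ltW bj0) X0.
  have -> : X * (beta j * b j / (1 + b j * X)) - (beta j - beta j / b j / X) =
    beta j / (b j * X * (1 + b j * X)).
    by field; rewrite !lt0r_neq0.
  by rewrite divr_ge0 ?mulr_ge0// ltW.
have [||c /andP[]] := @IVT R h 0 X 1 X0.
- exact/continuous_subspaceT.
- by rewrite h0 ge_min ler01/= le_max hX orbT.
rewrite bnd_simp => c0 _ hc1; exists c.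
have {}c0 : 0 < c.
  rewrite lt_neqAle c0 andbT; apply: contra_eq_neq hc1 => <-.
  by rewrite h0 eq_sym oner_eq0.
by split => //; move: hc1; rewrite /h ger0_norm ?(ltW c0).
Qed.

(** Dividing [fixpt_inv_sub] by [h] expresses the quotient exactly through [m h]. A uniform bound on
    the quotient gives [m h --> m0], and the limit is then taken inside the formula. *)
Lemma fixpt_deriv {mu dmu : R} {b db : 'I_L -> R} {m0 : R} {m : R -> R} :
  0 <= mu -> 0 <= dmu -> (forall j, 0 <= b j) -> (forall j, 0 <= db j) ->
  is_fixpt beta mu b m0 ->
  (forall h, 0 < h ->
    is_fixpt beta (mu + h * dmu) (fun j => b j + h * db j) (m h)) ->
  h^-1 * ((m h)^-1 - m0^-1) @[h --> 0^'+] -->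
    (dmu + \sum_j beta j * db j / (1 + b j * m0) ^+ 2) /
    slope beta mu b m0 m0.
Proof.
move=> mu0 dmu0 b0 db0 fm0 fm; have [m00 em0] := fm0.
have bh0 h j : 0 < h -> 0 <= b j + h * db j.
  by move=> h0; rewrite addr_ge0 ?mulr_ge0 ?(ltW h0).
have mh0 h : 0 < h -> 0 < m h by move=> /fm[].
have inv_ge h : 0 < h -> m0^-1 <= (m h)^-1.
  move=> h0; rewrite -subr_ge0.
  have mu_le : 0 <= mu <= mu + h * dmu by rewrite mu0 lerDl mulr_ge0 ?(ltW h0).
  have b_le j : 0 <= b j <= b j + h * db j.
    by rewrite b0 lerDl mulr_ge0 ?(ltW h0).
  apply: le_trans (fixpt_inv_le mu_le b_le fm0 (fm _ h0)).
  by rewrite subr_ge0; have /andP[] := mu_le.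
have m_le h : 0 < h -> m h <= m0.
  by move=> h0; rewrite -lef_pV2 ?posrE ?inv_ge// mh0.
have eqn h : 0 < h -> h^-1 * ((m h)^-1 - m0^-1) =
    (dmu + \sum_j beta j * db j /
                  ((1 + (b j + h * db j) * m h) * (1 + b j * m h)))
    / slope beta mu b m0 (m h).
  move=> h0; have sl0 := slope_gt0 mu0 b0 fm0 (mh0 _ h0).
  apply: (mulIf (lt0r_neq0 sl0)); rewrite divfK ?lt0r_neq0// -mulrA.
  rewrite (fixpt_inv_sub b0 (fun j => bh0 h j h0) fm0 (fm h h0)).
  rewrite (addrC mu) addrK mulrDr mulKf ?lt0r_neq0//; congr (_ + _).
  rewrite mulr_sumr; apply: eq_bigr => j _.
  rewrite (_ : b j + h * db j - b j = h * db j); last by rewrite addrC addKr.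
  by rewrite [beta j * _]mulrCA -!mulrA mulKf ?lt0r_neq0.
have invc : (m h)^-1 @[h --> 0^'+] --> m0^-1.
  (* Upper bound for the quotient: the numerator's denominators are at least 1, and [m h <= m0]
     makes [slope] at [m h] at least its value at [m0]. *)
  pose B := (dmu + \sum_j beta j * db j) / slope beta mu b m0 m0.
  apply: (@squeeze_cvgr _ _ _ _ (fun=> m0^-1) (fun h => m0^-1 + h * B)).
  - near=> h; have h0 : 0 < h by near: h; exact: nbhs_right_gt.
    have mh := mh0 _ h0.
    rewrite inv_ge//= -lerBlDl -ler_pdivrMl// eqn//.
    have sl0 := slope_gt0 mu0 b0 fm0 m00.
    apply: ler_pM.
    + rewrite addr_ge0// sumr_ge0// => j _.
      have := den_gt0 (bh0 _ j h0) (mh0 _ h0).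
      have := den_gt0 (b0 j) (mh0 _ h0) => /ltW ? /ltW ?.
      by rewrite divr_ge0 ?mulr_ge0 ?(ltW (beta_gt0 _)).
    + by rewrite invr_ge0 ltW// slope_gt0// mh0.
    + rewrite lerD2l ler_sum// => j _.
      rewrite ler_piMr ?mulr_ge0 ?(ltW (beta_gt0 _))//.
      rewrite invf_le1 ?mulr_gt0 ?den_gt0 ?bh0 ?mh//.
      rewrite mulr_ege1 ?lerDl ?mulr_ge0 ?bh0 ?(ltW (mh0 _ h0))//.
    + rewrite lef_pV2 ?posrE ?slope_gt0// ler_pM2l// lerD2l ler_sum// => j _.
      rewrite ler_wpM2l ?mulr_ge0 ?(ltW (beta_gt0 _))//.
      rewrite lef_pV2 ?posrE ?mulr_gt0 ?den_gt0 ?mh//.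
      by rewrite ler_pM2l ?den_gt0// lerD2l ler_wpM2l ?m_le.
  - exact: cvg_cst.
  - rewrite -[X in _ --> X]addr0; apply: cvgD; first exact: cvg_cst.
    rewrite -[X in _ --> X](mul0r B).
    apply: cvgM; last exact: cvg_cst.
    exact: cvg_at_right_filter cvg_id.
have mc : m h @[h --> 0^'+] --> m0.
  rewrite -[m0]invrK; under eq_fun do rewrite -[m _]invrK.
  by apply: cvgV invc; rewrite invr_eq0 lt0r_neq0.
apply: cvg_trans.
  apply: (near_eq_cvg (f := fun h => _)); near=> h; symmetry; apply: eqn.
  by near: h; exact: nbhs_right_gt.
have dc j : 1 + b j * m h @[h --> 0^'+] --> 1 + b j * m0.
  apply: cvgD; first exact: cvg_cst.
  by apply: cvgM mc; exact: cvg_cst.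
apply: cvgM.
  apply: cvgD; first exact: cvg_cst.
  apply: (cvg_big add_continuous) => j _; apply: cvgM; first exact: cvg_cst.
  apply: cvgV; first by rewrite expf_neq0// lt0r_neq0// den_gt0.
  rewrite expr2; apply: cvgM; last exact: dc.
  apply: cvgD; first exact: cvg_cst.
  apply: cvgM mc.
  rewrite -[X in _ --> X]addr0; apply: cvgD; first exact: cvg_cst.
  rewrite -[X in _ --> X](mul0r (db j)).
  apply: cvgM; last exact: cvg_cst.
  exact: cvg_at_right_filter cvg_id.
apply: cvgV; first by rewrite lt0r_neq0// slope_gt0.
apply: cvgM; first exact: cvg_cst.
apply: cvgD; first exact: cvg_cst.
apply: (cvg_big add_continuous) => j _; apply: cvgM; first exact: cvg_cst.
apply: cvgV; first by rewrite mulf_neq0// lt0r_neq0// den_gt0.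
by apply: cvgM; [exact: cvg_cst|exact: dc].
Unshelve. all: by end_near.
Qed.
End FixedPoint.

(* The condition under which [m_bar] is finite. *)
Definition active {R : realType} {L : nat} (beta : 'I_L -> R) (muk : R)
    (lam : 'I_L -> R) : bool :=
  (0 < muk) || ((muk == 0) && (1 < \sum_(j < L) beta j * (0 < lam j)%R%:R)).

(** * The functions [F]: monotonicity, growth and right derivatives *)

Section ResponseFunction.
Context {R : realType} {L : nat} {beta : 'I_L -> R} {eps : 'I_L -> 'I_L -> R}.
Hypothesis beta_gt0 : forall k, 0 < beta k.
Hypothesis eps_gt0 : forall j k, 0 < eps j k.

Lemma m_sol_fixpt (k : 'I_L) {muk : R} {lam : 'I_L -> R} :
  0 <= muk -> (forall j, 0 <= lam j) -> active beta muk lam ->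
  is_fixpt beta muk (fun j => lam j * eps j k) (m_sol beta eps k muk lam).
Proof.
move=> mu0 lam0 act.
have b0 j : 0 <= lam j * eps j k by rewrite mulr_ge0// ltW.
have [|m [m0 em]] := fixpt_exists beta_gt0 mu0 b0.
  case/orP: act => [->|/andP[_ s1]]; [by left|right].
  rewrite (eq_bigr (fun j => beta j * (0 < lam j)%R%:R))// => j _.
  by rewrite pmulr_lgt0.
have [] : [set m : R | 0 < m /\
    m = 1 / (muk + \sum_(j < L) 
                    beta j * lam j * eps j k / (1 + lam j * eps j k * m))]
    (m_sol beta eps k muk lam).
  apply: xgetPex; exists m; split=> //.
  under eq_bigr do rewrite -[beta _ * _ * _]mulrA.
  by rewrite div1r -(mulr1_eq em) invrK.
under eq_bigr do rewrite -[beta _ * _ * _]mulrA.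
set n := m_sol _ _ _ _ _ => n0 en; split => //.
(* A vanishing denominator would give [n = 1 / 0 = 0], contrary to [0 < n]. *)
rewrite {1}en div1r mulVf//; apply: contra_eq_neq en => ->.
by rewrite invr0 mulr0 gt_eqF.
Qed.

Lemma F_inactive (k : 'I_L) {lam : 'I_L -> R} {muk g : R} :
  ~~ active beta muk lam -> F beta eps k lam muk g = 0.
Proof.
rewrite /F /m_bar -/(active _ _ _) => /negbTE->.
by rewrite gt0_muley ?lte_fin// invey mule0.
Qed.

Lemma F_active (k : 'I_L) {lam : 'I_L -> R} {muk g : R} :
  0 <= muk -> (forall j, 0 <= lam j) -> active beta muk lam ->
  F beta eps k lam muk g = g / eps k k * (m_sol beta eps k muk lam)^-1.
Proof.
move=> mu0 lam0 act; have [m0 _] := m_sol_fixpt k mu0 lam0 act.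
rewrite /F /m_bar -/(active _ _ _) act -EFinM inver mulf_eq0.
by rewrite !gt_eqF//= invfM mulrA.
Qed.

Lemma active_le {muk muk' : R} {lam lam' : 'I_L -> R} :
  0 <= muk <= muk' -> (forall j, lam j <= lam' j) ->
  active beta muk lam -> active beta muk' lam'.
Proof.
move=> /andP[mu0 le_mu] le_lam; rewrite /active.
case/orP => [mu_gt0|/andP[_ s1]]; first by rewrite (lt_le_trans mu_gt0).
case: ltgtP (le_trans mu0 le_mu) => //= _ _; apply: (lt_le_trans s1).
apply: ler_sum => j _; rewrite ler_pM2l// ler_nat.
by case: ltP => // lam0; rewrite (lt_le_trans lam0).
Qed.

Lemma F_ge0 (k : 'I_L) {lam : 'I_L -> R} {muk g : R} : 0 < g ->
  0 <= muk -> (forall j, 0 <= lam j) -> 0 <= F beta eps k lam muk g.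
Proof.
move=> g0 mu0 lam0; have [act|/F_inactive->//] := boolP (active beta muk lam).
have [m0 _] := m_sol_fixpt k mu0 lam0 act.
by rewrite F_active// divr_ge0 ?divr_ge0 ?ltW.
Qed.

(** When the left side is active, so is the right, and [fixpt_inv_le] applies with equal [mu]; when
    it is inactive, it is 0. *)
Lemma F_le_lam (k : 'I_L) {lam lam' : 'I_L -> R} {muk g : R} : 0 < g ->
  0 <= muk -> (forall j, 0 <= lam j <= lam' j) ->
  F beta eps k lam muk g <= F beta eps k lam' muk g.
Proof.
move=> g0 mu0 le_lam.
have lam0 j : 0 <= lam j by have /andP[] := le_lam j.
have lam'0 j : 0 <= lam' j by have /andP[/le_trans] := le_lam j; apply.
have [act|/F_inactive->] := boolP (active beta muk lam); last exact: F_ge0.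
have act' : active beta muk lam'.
  apply: active_le act; first by rewrite mu0 lexx.
  by move=> j; have /andP[] := le_lam j.
rewrite !F_active// ler_pM2l ?divr_gt0// -subr_ge0 -{1}(subrr muk).
apply: fixpt_inv_le (m_sol_fixpt _ mu0 lam0 act)
                    (m_sol_fixpt _ mu0 lam'0 act') => //.
  by rewrite mu0 lexx.
move=> j; have /andP[? ?] := le_lam j.
by rewrite mulr_ge0 ?(ltW (eps_gt0 _ _))//= ler_pM2r.
Qed.

(** The rate persists across a switch from inactive to active: there [F] starts from 0, and the
    fixed-point equation at [muk + h] gives [m^-1 >= muk + h]. *)
Lemma F_incr_mu (k : 'I_L) {lam : 'I_L -> R} {muk h g : R} : 0 < g ->
  0 <= muk -> 0 < h -> (forall j, 0 <= lam j) ->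
  h * (g / eps k k) <= F beta eps k lam (muk + h) g - F beta eps k lam muk g.
Proof.
move=> g0 mu0 h0 lam0.
have muh0 : 0 < muk + h by rewrite ltr_wpDl.
have acth : active beta (muk + h) lam by rewrite /active muh0.
have fh := m_sol_fixpt k (ltW muh0) lam0 acth.
rewrite F_active ?(ltW muh0)//.
have [act|nact] := boolP (active beta muk lam).
  rewrite F_active// -mulrBr mulrC ler_pM2l ?divr_gt0//.
  rewrite -{1}(addKr muk h) addrC.
  apply: fixpt_inv_le (m_sol_fixpt _ mu0 lam0 act) fh => //.
    by rewrite mu0 lerDl ltW.
  by move=> j; rewrite lexx mulr_ge0 ?(ltW (eps_gt0 _ _)).
rewrite F_inactive// subr0 mulrC ler_pM2l ?divr_gt0//.
have [m0 em] := fh.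
rewrite (mulr1_eq em) -addrA addrCA lerDl addr_ge0// sumr_ge0// => j _.
have le0 := ltW (eps_gt0 j k); have lb0 := ltW (beta_gt0 j).
by rewrite divr_ge0 ?mulr_ge0// addr_ge0 ?mulr_ge0// ltW.
Qed.

(** Nonnegative directions preserve activity, so [fixpt_deriv] applies. Its [slope] is [m] times the
    last denominator here, and this [m] supplies the factor [F]. The direction is general in order
    to serve both stationarity conditions. *)
Lemma F_right_deriv (k : 'I_L) {lam dlam : 'I_L -> R} {muk dmu g : R} :
  0 <= muk -> (forall j, 0 <= lam j) -> 0 <= dmu -> (forall j, 0 <= dlam j) ->
  active beta muk lam ->
  let m := m_sol beta eps k muk lam in
  h^-1 * (F beta eps k (fun j => lam j + h * dlam j) (muk + h * dmu) g -
          F beta eps k lam muk g) @[h --> 0^'+] -->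
  F beta eps k lam muk g *
    ((dmu + \sum_j beta j * (dlam j * eps j k) /
                   (1 + lam j * eps j k * m) ^+ 2) /
     (muk + \sum_j beta j * (lam j * eps j k) /
                   (1 + lam j * eps j k * m) ^+ 2)).
Proof.
move=> mu0 lam0 dmu0 dlam0 act m.
have fm := m_sol_fixpt k mu0 lam0 act; have [m0 _] := fm.
have muh h : 0 < h -> 0 <= muk + h * dmu.
  by move=> /ltW h0; rewrite addr_ge0 ?mulr_ge0.
have lamh h j : 0 < h -> 0 <= lam j + h * dlam j.
  by move=> /ltW h0; rewrite addr_ge0 ?mulr_ge0.
have acth h : 0 < h ->
    active beta (muk + h * dmu) (fun j => lam j + h * dlam j).
  move=> /ltW h0; apply: active_le act; first by rewrite mu0 lerDl mulr_ge0.
  by move=> j; rewrite lerDl mulr_ge0.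
have b0 j : 0 <= lam j * eps j k by rewrite mulr_ge0// ltW.
have db0 j : 0 <= dlam j * eps j k by rewrite mulr_ge0// ltW.
pose mh h := m_sol beta eps k (muk + h * dmu) (fun j => lam j + h * dlam j).
have fmh h : 0 < h -> is_fixpt beta (muk + h * dmu)
    (fun j => lam j * eps j k + h * (dlam j * eps j k)) (mh h).
  move=> h0; have := m_sol_fixpt k (muh _ h0) (lamh _ ^~ h0) (acth _ h0).
  by congr is_fixpt; apply/funext => j; rewrite mulrDl mulrA.
have := fixpt_deriv beta_gt0 mu0 dmu0 b0 db0 fm fmh.
rewrite -/m => /(cvgM (@cvg_cst _ (g / eps k k) _ _ _)) D.
rewrite F_active//.
have slopeE : slope beta muk (fun j => lam j * eps j k) m m = m *
    (muk + \sum_j beta j * (lam j * eps j k) / (1 + lam j * eps j k * m) ^+ 2).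
  by rewrite /slope; under eq_bigr do rewrite -expr2.
rewrite -/m; move: D; rewrite slopeE; set N := dmu + _; set Y := muk + _ => D.
have -> : g / eps k k / m * (N / Y) = g / eps k k * (N / (m * Y)).
  by rewrite invfM; ring.
apply: cvg_trans D; apply: near_eq_cvg; near=> h.
have h0 : 0 < h by near: h; exact: nbhs_right_gt.
rewrite F_active ?muh ?acth//; last by move=> j; exact: lamh.
by rewrite -mulrBr mulrCA.
Unshelve. all: by end_near.
Qed.

End ResponseFunction.

(** * Tools: right derivatives, coordinate updates, positive affine systems *)

Lemma has_deriv_nneg_right {R : realType} {f : R -> R} {t d : R} :
  has_deriv_nneg f t d -> h^-1 * (f (t + h) - f t) @[h --> 0^'+] --> d.
Proof.
rewrite /has_deriv_nneg; case: eqP => // _ [df <-].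
apply: cvg_trans (cvg_dnbhs_at_right df).
apply: near_eq_cvg; near=> h => /=.
by rewrite (_ : h%:A = h) ?(addrC h)//; exact: mulr1.
Unshelve. all: by end_near.
Qed.

Lemma sum_update {R : realType} {L : nat} (G : 'I_L -> R -> R) (v : 'I_L -> R)
    (k : 'I_L) (t : R) :
  \sum_j G j ([eta v with k |-> t] j) = G k t + \sum_(j | j != k) G j (v j).
Proof.
rewrite (bigD1 k)//= eqxx; congr (_ + _).
by apply: eq_bigr => j /negbTE /= ->.
Qed.

Lemma eta_with_id {T : eqType} {U : Type} (v : T -> U) (k : T) :
  [eta v with k |-> v k] = v :> (T -> U).
Proof. by apply/funext => j /=; case: eqP => [->|]. Qed.

(* Look at the index maximizing |Q - P| / P. *)
Lemma affine_system_unique {R : realType} {L : nat} {K : {set 'I_L}}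
    {c : 'I_L -> R} {B : 'I_L -> 'I_L -> R} {P Q : 'I_L -> R} :
  (forall k, k \in K -> 0 < c k) -> (forall k j, k \in K -> 0 <= B k j) ->
  (forall k, k \in K -> 0 < P k) ->
  (forall k, k \in K -> P k = c k + \sum_(j in K) B k j * P j) ->
  (forall k, k \in K -> Q k = c k + \sum_(j in K) B k j * Q j) ->
  forall k, k \in K -> Q k = P k.
Proof.
move=> c0 B0 P0 eqP_ eqQ k kK.
pose r j := `|Q j - P j| / P j.
have [i iK rmax] : exists2 i, i \in K & forall j, j \in K -> r j <= r i.
  by case: (Order.TotalTheory.arg_maxP r kK) => i; exists i.
have D_le j : j \in K -> `|Q j - P j| <= r i * P j.
  by move=> jK; rewrite -ler_pdivrMr ?P0//; exact: rmax.
have ri_le0 : r i <= 0.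
  rewrite -(pmulr_lle0 _ (c0 i iK)).
  (* [Q - P] solves the homogeneous system, so its norm at [i] is at most [r i] times the sum of
     [B i j * P j], and that sum is [P i - c i]. *)
  have : r i * P i <= r i * (P i - c i).
    rewrite divfK ?lt0r_neq0 ?P0//.
    rewrite {1}(eqP_ _ iK) {1}(eqQ _ iK) opprD addrACA subrr add0r -sumrB.
    rewrite {1}(eqP_ _ iK) addrC addKr mulr_sumr.
    apply: le_trans (ler_norm_sum _ _ _) _; apply: ler_sum => j jK.
    rewrite -mulrBr normrM (ger0_norm (B0 _ _ iK)).
    by rewrite mulrCA ler_wpM2l ?B0 ?D_le.
  by rewrite mulrBr lerDl oppr_ge0.
apply/eqP; rewrite -subr_eq0 -normr_le0; apply: le_trans (D_le _ kK) _.
by rewrite mulr_le0_ge0// ltW// P0.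
Qed.

(** * Consequences of the KKT conditions: signs and tight constraints *)

Section KKTConsequences.
Context {R : realType} {L : nat} {sigma2 : R} {beta gamma : 'I_L -> R}.
Context {eps : 'I_L -> 'I_L -> R} {mu lam x zk : 'I_L -> R} {z : R}.
Hypotheses (sigma2_gt0 : 0 < sigma2) (beta_gt0 : forall k, 0 < beta k).
Hypotheses (gamma_gt0 : forall k, 0 < gamma k).
Hypotheses (eps_gt0 : forall j k, 0 < eps j k).
Hypothesis feas : dual_feasible beta gamma eps mu lam.
Hypothesis kkt : KKT sigma2 beta gamma eps mu lam x zk z.

Let Fk (k : 'I_L) (l : 'I_L -> R) (m : R) := F beta eps k l m (gamma k).

Let mu_ge0 k : 0 <= mu k. Proof. by have [/(_ k)] := feas. Qed.
Let lam_ge0 k : 0 <= lam k. Proof. by have [_ /(_ k)] := feas. Qed.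
Let x_ge0 k : 0 <= x k. Proof. by have [[/(_ k)]] := kkt. Qed.
Let zk_ge0 k : 0 <= zk k. Proof. by have [[_ [/(_ k)]]] := kkt. Qed.

(** Among the terms with [F], only the [k]-th involves [mu k]. The limit form presupposes no formula
    for the derivative of [Fk], so it also serves inactive indices. *)
Lemma kkt_mu k :
  x k - z + zk k * (h^-1 * (Fk k lam (mu k + h) - Fk k lam (mu k)))
    @[h --> 0^'+] --> 0.
Proof.
have [_ /(_ k) /has_deriv_nneg_right D _ _] := kkt.
apply: cvg_trans D; apply: near_eq_cvg; near=> h.
have h0 : 0 < h by near: h; exact: nbhs_right_gt.
rewrite /lagrangian.
have E t : sigma2 * (\sum_(k0 < L) lam k0 * beta k0) +
    \sum_(k0 < L) [eta mu with k |-> t] k0 * x k0 +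
    z * (\sum_(k0 < L) (1 - [eta mu with k |-> t] k0)) +
    \sum_(k0 < L) zk k0 *
      (F beta eps k0 lam ([eta mu with k |-> t] k0) (gamma k0) - lam k0) =
    sigma2 * (\sum_(k0 < L) lam k0 * beta k0) +
    (t * x k + \sum_(j | j != k) mu j * x j) +
    z * ((1 - t) + \sum_(j | j != k) (1 - mu j)) +
    (zk k * (Fk k lam t - lam k) +
      \sum_(j | j != k) zk j * (F beta eps j lam (mu j) (gamma j) - lam j)).
  by rewrite (sum_update (fun j t => t * x j))
    (sum_update (fun j t => 1 - t))
    (sum_update (fun j t => zk j * (F beta eps j lam t (gamma j) - lam j))).
rewrite !E; field; exact: lt0r_neq0.
Unshelve. all: by end_near.
Qed.

(** Changing [lam k] affects every [Fk j]. Convergence is asserted for the whole sum only; this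
    already suffices for sign arguments. *)
Lemma kkt_lam k : exists d : R, [/\ d <= 0, 0 < lam k -> d = 0 &
  sigma2 * beta k - zk k + \sum_j zk j * (h^-1 *
    (Fk j [eta lam with k |-> lam k + h] (mu j) - Fk j lam (mu j)))
    @[h --> 0^'+] --> d].
Proof.
have [_ _ /(_ k) [d [/has_deriv_nneg_right D d0 d_eq0]] _] := kkt.
exists d; split => //.
apply: cvg_trans D; apply: near_eq_cvg; near=> h.
have h0 : 0 < h by near: h; exact: nbhs_right_gt.
rewrite eta_with_id /lagrangian.
rewrite (sum_update (fun j t => t * beta j)).
rewrite [X in _ - (sigma2 * X + _ + _ + _)](bigD1 k)//=.
set S := \sum_(j | j != k) _; set A := \sum_j mu j * x j; set B := z * _.
under eq_bigr do rewrite mulrBr.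
under [X in _ - (_ + X)]eq_bigr do rewrite mulrBr.
rewrite !sumrB.
rewrite (sum_update (fun j t => zk j * t)) [X in _ - (_ + (_ - X))](bigD1 k)//=.
set T := \sum_(j | j != k) _.
under [X in _ = _ + X]eq_bigr do rewrite mulrCA [zk _ * _]mulrBr.
rewrite -mulr_sumr sumrB /Fk.
set U := \sum_j _; set V := \sum_j _.
field; exact: lt0r_neq0.
Unshelve. all: by end_near.
Qed.

Lemma zk_lower_bound k : sigma2 * beta k <= zk k.
Proof.
have [d [d0 _ D]] := kkt_lam k; rewrite -subr_le0; apply: le_trans d0.
apply: (cvgr_to_ge D); near=> h.
have h0 : 0 < h by near: h; exact: nbhs_right_gt.
rewrite lerDl sumr_ge0// => j _.
rewrite mulr_ge0 ?zk_ge0// mulr_ge0 ?invr_ge0 ?(ltW h0)//.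
rewrite subr_ge0; apply: F_le_lam => // i /=.
by case: eqP => [->|_]; rewrite lam_ge0 ?lexx// lerDl ltW.
Unshelve. all: by end_near.
Qed.

Lemma zk_gt0 k : 0 < zk k.
Proof. by apply: lt_le_trans (zk_lower_bound k); rewrite mulr_gt0. Qed.

Lemma lam_eq_F k : lam k = Fk k lam (mu k).
Proof.
have [_ _ _ [_ _ /(_ k)/eqP]] := kkt.
by rewrite mulf_eq0 gt_eqF ?zk_gt0//= subr_eq0 => /eqP.
Qed.

(** Tightness [lam k = F_k] identifies the selected indices with those where [F_right_deriv]
    applies. *)
Lemma lam_gt0_active k : (0 < lam k) = active beta (mu k) lam.
Proof.
have [act|/(F_inactive eps_gt0 k) Fk0] := boolP (active beta (mu k) lam);
  last first.
  by rewrite lam_eq_F /Fk Fk0 ltxx.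
have [m0 _] := m_sol_fixpt beta_gt0 eps_gt0 k (mu_ge0 k) lam_ge0 act.
by rewrite lam_eq_F /Fk F_active// !mulr_gt0// invr_gt0.
Qed.

(** The quotients in [kkt_mu] are bounded below by [F_incr_mu], for unselected indices too, and the
    bound passes to the limit. *)
Lemma z_lower_bound k : zk k * (gamma k / eps k k) <= z - x k.
Proof.
rewrite -subr_le0 addrC opprB; apply: (cvgr_to_ge (kkt_mu k)); near=> h.
have h0 : 0 < h by near: h; exact: nbhs_right_gt.
rewrite lerD2l ler_pM2l ?zk_gt0// ler_pdivlMl//.
exact: F_incr_mu.
Unshelve. all: by end_near.
Qed.

Lemma power_gt0 k : 0 < z - x k.
Proof.
by apply: lt_le_trans (z_lower_bound k); rewrite mulr_gt0 ?zk_gt0 ?divr_gt0.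
Qed.

Lemma sum_mu : (0 < L)%N -> \sum_k mu k = L%:R.
Proof.
move=> L0; have [_ _ _ [_ + _]] := kkt => /eqP.
have z0 : 0 < z by apply: lt_le_trans (power_gt0 (Ordinal L0)) _; rewrite gerBl.
rewrite mulf_eq0 gt_eqF//= sumrB subr_eq0 => /eqP <-.
by rewrite sumr_const card_ord.
Qed.

(** * The powers [z - x k] and the equations they satisfy *)

Let m k := gamma k / (eps k k * lam k).
(** The denominator in [gamma'], summed over all [j] since terms with [lam j = 0] vanish. For
    selected [k], [m k * Y k] is the [slope] at the fixed point, hence positive. *)
Let Y k := mu k +
  \sum_j beta j * (lam j * eps j k) / (1 + lam j * eps j k * m k) ^+ 2.

Lemma m_solE k : 0 < lam k -> m_sol beta eps k (mu k) lam = m k.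
Proof.
move=> lk0; have act : active beta (mu k) lam by rewrite -lam_gt0_active.
have [m0 _] := m_sol_fixpt beta_gt0 eps_gt0 k (mu_ge0 k) lam_ge0 act.
rewrite /m lam_eq_F /Fk F_active//.
by field; rewrite !lt0r_neq0.
Qed.

Lemma m_fixpt k : 0 < lam k ->
  is_fixpt beta (mu k) (fun j => lam j * eps j k) (m k).
Proof.
move=> lk0; rewrite -m_solE//; apply: m_sol_fixpt => //.
by rewrite -lam_gt0_active.
Qed.

Lemma Y_gt0 k : 0 < lam k -> 0 < Y k.
Proof.
move=> lk0; have fm := m_fixpt k lk0; have [m0 _] := fm.
have b0 j : 0 <= lam j * eps j k by rewrite mulr_ge0// ltW.
have := slope_gt0 beta_gt0 (mu_ge0 k) b0 fm m0.
by rewrite /slope pmulr_rgt0// /Y; under eq_bigr do rewrite -expr2.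
Qed.

(** [F_right_deriv] in the direction of [mu k] alone gives a second limit for the expression in
    [kkt_mu]; the two limits agree. *)
Lemma power_eq k : 0 < lam k -> z - x k = zk k * (lam k / Y k).
Proof.
move=> lk0; have act : active beta (mu k) lam by rewrite -lam_gt0_active.
have := F_right_deriv beta_gt0 eps_gt0 k (g := gamma k) (mu_ge0 k) lam_ge0 ler01
  (fun=> lexx 0) act.
rewrite /= m_solE// -/(Fk k lam (mu k)) -lam_eq_F -/(Y k).
rewrite big1 ?addr0; last by move=> j _; rewrite !(mul0r, mulr0).
rewrite mul1r => D.
have {}D : x k - z + zk k * (h^-1 * (Fk k lam (mu k + h) - Fk k lam (mu k)))
    @[h --> 0^'+] --> x k - z + zk k * (lam k / Y k).
  apply: cvgD; first exact: cvg_cst.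
  apply: cvgM; first exact: cvg_cst.
  apply: cvg_trans D; apply: near_eq_cvg; near=> h.
  rewrite mulr1 -(lam_eq_F k) /Fk; congr (_ * (F _ _ _ _ _ _ - _)).
  by apply/funext => j; rewrite mulr0 addr0.
have : x k - z + zk k * (lam k / Y k) = 0.
  exact: (cvg_unique _ D (kkt_mu k)).
by move=> /eqP; rewrite addrC addr_eq0 opprB => /eqP.
Unshelve. all: by end_near.
Qed.

(** For [lam k > 0] the limit in [kkt_lam] is 0 and can be computed termwise. An active [j]
    contributes [zk j * lam j / Y j], which is [z - x j] by [power_eq], times an explicit factor; an
    inactive [j] contributes 0. *)
Lemma zk_eq k : 0 < lam k -> zk k = beta k * (sigma2 +
  \sum_(j in K_sel lam) (z - x j) * eps k j / (1 + lam k * eps k j * m j) ^+ 2).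
Proof.
move=> lk0; have [d [_ /(_ lk0)-> D]] := kkt_lam k.
have D' : sigma2 * beta k - zk k + \sum_j zk j * (h^-1 *
    (Fk j [eta lam with k |-> lam k + h] (mu j) - Fk j lam (mu j)))
    @[h --> 0^'+] --> sigma2 * beta k - zk k + \sum_j
     (if 0 < lam j then beta k * ((z - x j) * eps k j /
                                  (1 + lam k * eps k j * m j) ^+ 2) else 0).
  apply: cvgD; first exact: cvg_cst.
  apply: (cvg_big add_continuous) => j _; case: ifPn => [lj0|].
    have act : active beta (mu j) lam by rewrite -lam_gt0_active.
    have := F_right_deriv beta_gt0 eps_gt0 j (g := gamma j) (mu_ge0 j) lam_ge0
      (lexx 0) (dlam := fun i => (i == k)%:R) (fun=> ler0n _ _) act.
    rewrite /= m_solE// -/(Fk j lam (mu j)) -lam_eq_F -/(Y j) add0r.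
    rewrite (bigD1 k)//= eqxx mul1r big1 ?addr0; last first.
      by move=> i /negbTE ->; rewrite !(mul0r, mulr0).
    move=> Dj; rewrite power_eq//.
    rewrite (_ : beta k * _ = zk j * (lam j * (beta k * eps k j /
      (1 + lam k * eps k j * m j) ^+ 2 / Y j))); last by ring.
    apply: cvgM; first exact: cvg_cst.
    apply: cvg_trans Dj; apply: near_eq_cvg; near=> h.
    rewrite mulr0 addr0 /Fk; congr (_ * (F _ _ _ _ _ _ - _)).
    by apply/funext => i /=; case: eqP => [->|_]; rewrite ?mulr1 ?mulr0 ?addr0.
  (* Since lam k is already positive, increasing it leaves the support of lam,
     hence the inactivity of F_j, unchanged. *)
  rewrite lam_gt0_active => nact.
  have C0 : (0 : R) @[h --> (0 : R)^'+] --> (0 : R) by exact: cvg_cst.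
  apply: cvg_trans C0; apply: near_eq_cvg; near=> h.
  have h0 : 0 < h by near: h; exact: nbhs_right_gt.
  rewrite /Fk !F_inactive// ?subrr ?mulr0//.
  move: nact; rewrite /active; congr (~~ (_ || (_ && (_ < _)))).
  apply: eq_bigr => i _ /=; case: eqP => [->|//].
  by rewrite lk0 addr_gt0.
have S0 : sigma2 * beta k - zk k + \sum_j
    (if 0 < lam j then beta k * ((z - x j) * eps k j /
                                 (1 + lam k * eps k j * m j) ^+ 2) else 0) = 0.
  exact: (cvg_unique _ D' D).
apply/eqP; rewrite mulrDr mulr_sumr eq_sym -subr_eq0; apply/eqP.
rewrite -[RHS]S0 (mulrC sigma2) addrAC; congr (_ + _).
rewrite [LHS]big_mkcond/=.
by apply: eq_bigr => j _; rewrite /K_sel inE.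
Unshelve. all: by end_near.
Qed.

Let lam_eq0 j : j \notin K_sel lam -> lam j = 0.
Proof.
by rewrite /K_sel inE -leNgt => lj0; apply/eqP; rewrite eq_le lj0 lam_ge0.
Qed.

Lemma sum_K_sel (G : 'I_L -> R) : (forall j, lam j = 0 -> G j = 0) ->
  \sum_(j in K_sel lam) G j = \sum_j G j.
Proof.
move=> G0; rewrite big_mkcond; apply: eq_bigr => j _.
by case: ifPn => // /lam_eq0/G0.
Qed.

(** Multiply [zk_eq] by [lam k], sum over selected [k] and exchange sums. The inner sum is
    [Y j - mu j], so [power_eq] and [mu j * x j = 0] give [zk j * lam j - mu j * z]; the sums of
    [zk j * lam j] cancel. *)
Lemma z_eq : (0 < L)%N -> z = sigma2 / L%:R * \sum_k beta k * lam k.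
Proof.
move=> L0; have L_neq0 : L%:R != 0 :> R by rewrite pnatr_eq0 -lt0n.
suff zL : z * L%:R = sigma2 * \sum_k beta k * lam k.
  rewrite mulrAC -zL.  by rewrite mulfK.
pose B k j := eps k j / (1 + lam k * eps k j * m j) ^+ 2.
have zkE k : k \in K_sel lam -> zk k * lam k = sigma2 * (beta k * lam k) +
    \sum_(j in K_sel lam) (z - x j) * (beta k * lam k * B k j).
  rewrite /K_sel inE => lk0; rewrite {1}zk_eq// mulrAC mulrDr (mulrC _ sigma2).
  congr (_ + _); rewrite mulr_sumr; apply: eq_bigr => j _.
  by rewrite /B; ring.
have YE j : j \in K_sel lam ->
    (z - x j) * \sum_(k in K_sel lam) beta k * lam k * B k j =
    zk j * lam j - mu j * z.
  rewrite /K_sel inE => lj0; have Yj0 := Y_gt0 j lj0.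
  have -> : \sum_(k in K_sel lam) beta k * lam k * B k j = Y j - mu j.
    rewrite /Y addrC addKr sum_K_sel; last by move=> k ->; rewrite mulr0 mul0r.
    by apply: eq_bigr => k _; rewrite /B !mulrA.
  rewrite mulrBr {1}power_eq// -mulrA divfK ?lt0r_neq0//; congr (_ - _).
  have [_ _ _ [/(_ j) mux _ _]] := kkt.
  by rewrite mulrC mulrBr mux subr0.
(* An unselected index is inactive, which forces [mu j = 0]. *)
have muK : \sum_(j in K_sel lam) mu j = L%:R.
  rewrite -(sum_mu L0); apply: sum_K_sel => j lj0.
  have := lam_gt0_active j; rewrite lj0 ltxx /active => /esym/negbT.
  by rewrite negb_or -leNgt => /andP[mj _]; apply/eqP; rewrite eq_le mj mu_ge0.
have -> : \sum_k beta k * lam k = \sum_(k in K_sel lam) beta k * lam k.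
  by rewrite sum_K_sel// => k ->; rewrite mulr0.
rewrite -muK.
have : \sum_(k in K_sel lam) zk k * lam k =
    sigma2 * \sum_(k in K_sel lam) beta k * lam k +
    \sum_(j in K_sel lam) (zk j * lam j - mu j * z).
  rewrite (eq_bigr _ zkE) big_split/= -mulr_sumr; congr (_ + _).
  rewrite exchange_big/=; apply: eq_bigr => j jK.
  by rewrite -mulr_sumr YE.
rewrite sumrB addrCA -[LHS]addr0 => /addrI/esym/eqP.
rewrite subr_eq0 => /eqP ->.
by rewrite -mulr_suml mulrC.
Qed.

(** The numerator in [gamma'] is [(m k)^-1] by the fixed-point equation, and
    [gamma k / m k = lam k * eps k k]. *)
Lemma gamma'E k : 0 < lam k ->
  gamma' beta gamma eps mu lam k = lam k * eps k k / Y k.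
Proof.
move=> lk0; have [mk0 em] := m_fixpt k lk0; rewrite /gamma'.
rewrite !sum_K_sel; try by move=> j ->; rewrite !(mulr0, mul0r).
rewrite (eq_bigr (fun j => beta j * (lam j * eps j k) /
  (1 + lam j * eps j k * m k))); last first.
  by move=> j _; rewrite [in RHS]mulrA.
rewrite -(mulr1_eq em) (eq_bigr (fun j => beta j * (lam j * eps j k) /
  (1 + lam j * eps j k * m k) ^+ 2)); last first.
  by move=> j _; rewrite [in RHS]mulrA.
rewrite -/(Y k) /m; have := Y_gt0 k lk0 => Yk0.
by field; rewrite !lt0r_neq0.
Qed.

Lemma powers_solve_equations :
  power_equations sigma2 beta gamma eps mu lam (fun k => z - x k).
Proof.
move=> k; rewrite /K_sel inE => lk0; rewrite gamma'E// -zk_eq// power_eq//.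
have := Y_gt0 k lk0 => Yk0; have := zk_gt0 k => zk0.
by field; rewrite !lt0r_neq0.
Qed.

Lemma power_equations_affine (Q : 'I_L -> R) :
  power_equations sigma2 beta gamma eps mu lam Q -> forall k, k \in K_sel lam ->
  let c := gamma' beta gamma eps mu lam k / eps k k * beta k in
  Q k = c * sigma2 + \sum_(j in K_sel lam)
    c * (eps k j / (1 + lam k * eps k j * m j) ^+ 2) * Q j.
Proof.
move=> eqQ k kK /=; have lk0 : 0 < lam k by move: kK; rewrite /K_sel inE.
have g0 : 0 < gamma' beta gamma eps mu lam k.
  by rewrite gamma'E// divr_gt0 ?Y_gt0// mulr_gt0.
have := eqQ k kK; set D := beta k * _ => eqD.
(* The sign of [Q] is unknown. If [D] vanished, the quotient would be 0 by convention, contradicting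
   [gamma' > 0]. *)
have D0 : D != 0.
  by apply: contraTneq g0 => D0; rewrite -eqD D0 invr0 mulr0 ltxx.
have -> : Q k = gamma' beta gamma eps mu lam k / eps k k * D.
  by rewrite -eqD; field; rewrite D0 lt0r_neq0.
rewrite /D mulrA mulrDr; congr (_ + _); rewrite mulr_sumr.
by apply: eq_bigr => j _; ring.
Qed.

End KKTConsequences.

Theorem lemma4 (R : realType) (L : nat) (hL : (1 <= L)%N)
    (sigma2 : R) (beta gamma : 'I_L -> R) (eps : 'I_L -> 'I_L -> R)
    (hsigma2 : 0 < sigma2) (hbeta : forall k, 0 < beta k)
    (hgamma : forall k, 0 < gamma k) (heps : forall j k, 0 < eps j k)
    (hfinite : dual_value sigma2 beta gamma eps \is a fin_num)
    (mu lam : 'I_L -> R)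
    (hopt : dual_optimal sigma2 beta gamma eps mu lam)
    (x zk : 'I_L -> R) (z : R)
    (hKKT : KKT sigma2 beta gamma eps mu lam x zk z) :
  (forall k, 0 <= x k) /\
  (forall k, mu k * x k = 0) /\
  (forall k, lam k = F beta eps k lam (mu k) (gamma k)) /\
  \sum_(k < L) mu k = L%:R /\
  z = sigma2 / L%:R * \sum_(k < L) beta k * lam k /\
  exists P : 'I_L -> R,
    [/\ power_equations sigma2 beta gamma eps mu lam P,
        forall Q : 'I_L -> R, power_equations sigma2 beta gamma eps mu lam Q ->
          forall k, k \in K_sel lam -> Q k = P k &
        forall k, k \in K_sel lam -> x k = z - P k].
Proof.
have [feas _] := hopt; have [[x_ge0 _] _ _ [mux _ _]] := hKKT.
split; [exact: x_ge0|split; [exact: mux|split]].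
  exact: (lam_eq_F hsigma2 hbeta hgamma heps feas hKKT).
split; first exact: (sum_mu hsigma2 hbeta hgamma heps feas hKKT hL).
split; first exact: (z_eq hsigma2 hbeta hgamma heps feas hKKT hL).
have eqP_ := powers_solve_equations hsigma2 hbeta hgamma heps feas hKKT.
exists (fun k => z - x k); split => [//|Q eqQ|k _]; last first.
  by rewrite opprB addrC subrK.
have g0 k : k \in K_sel lam -> 0 < gamma' beta gamma eps mu lam k.
  rewrite /K_sel inE => lk0.
  rewrite (gamma'E hsigma2 hbeta hgamma heps feas hKKT)//.
  by rewrite divr_gt0 ?(Y_gt0 hsigma2 hbeta hgamma heps feas hKKT)// mulr_gt0.
pose c k := gamma' beta gamma eps mu lam k / eps k k * beta k.
have c0 k : k \in K_sel lam -> 0 < c k.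
  by move=> kK; rewrite mulr_gt0// divr_gt0// g0.
have affine := power_equations_affine hsigma2 hbeta hgamma heps feas hKKT.
(* The positive solution required here is [z - x k]; the competitor [Q] may have any sign. *)
apply: (affine_system_unique (c := fun k => c k * sigma2) _ _ _
  (affine _ eqP_) (affine _ eqQ)).
- by move=> k kK; rewrite mulr_gt0// c0.
- move=> k j kK; rewrite mulr_ge0 ?(ltW (c0 k kK))//.
  by rewrite divr_ge0 ?(ltW (heps _ _)) ?sqr_ge0.
- by move=> k _; apply: (power_gt0 hsigma2 hbeta hgamma heps feas hKKT).
Qed.
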